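(* Let $\mathfrak{q}=\mathfrak{l}\oplus\mathfrak{g}(1)\oplus\mathfrak{z}(\mathfrak{n})$ be a maximal parabolic subalgebra of quasi-Heisenberg type of one of the types $B_n(i)$ ($3\le i\le n$), $C_n(i)$ ($2\le i\le n-1$), $D_n(i)$ ($3\le i\le n-3$), $E_6(3)$, $E_6(5)$, $E_7(2)$, $E_7(6)$, $E_8(1)$, $F_4(4)$. Then the covariant map $\tau_2:\mathfrak{g}(1)\to\mathfrak{l}\otimes\mathfrak{z}(\mathfrak{n})$, $\tau_2(X)=\frac12(\mathrm{ad}(X)^2\otimes\mathrm{Id})\omega$, is not identically zero.
   Context: $\mathfrak{g}$ is a complex simple Lie algebra with Borel subalgebra $\mathfrak{b}\supset\mathfrak{h}$ (Cartan), roots $\Delta$, simple roots $\Pi$, Killing form $\kappa$. ''$\mathfrak{q}$ is of type $\mathcal{T}(i)$'' means $\mathfrak{g}$ has type $\mathcal{T}$ and $\mathfrak{q}=\mathfrak{l}\oplus\mathfrak{n}$ is the standard maximal parabolic determined by $\alpha_\mathfrak{q}=\alpha_i$ (Bourbaki numbering): $\mathfrak{l}=\mathfrak{h}$ plus root spaces for roots in $\mathrm{span}(\Pi\setminus\{\alpha_\mathfrak{q}\})$, $\mathfrak{n}$ the remaining positive root spaces. Quasi-Heisenberg type: $[\mathfrak{n},[\mathfrak{n},\mathfrak{n}]]=0$, $\dim[\mathfrak{n},\mathfrak{n}]>1$. Grading by the coefficient of $\alpha_\mathfrak{q}$: $\mathfrak{g}=\bigoplus_{j=-2}^2\mathfrak{g}(j)$,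 $\mathfrak{l}=\mathfrak{g}(0)$, $\mathfrak{z}(\mathfrak{n})=\mathfrak{g}(2)$, $\mathfrak{z}(\bar{\mathfrak{n}})=\mathfrak{g}(-2)$. $\omega=\sum_jX_j^*\otimes X_j\in\mathfrak{z}(\bar{\mathfrak{n}})\otimes\mathfrak{z}(\mathfrak{n})$, with $\{X_j\}$ a basis of $\mathfrak{z}(\mathfrak{n})$ and $\{X_j^*\}$ its $\kappa$-dual basis of $\mathfrak{z}(\bar{\mathfrak{n}})$. *)

(* Defs.v *)
From HB Require Import structures.
From mathcomp Require Import all_boot all_order all_algebra.
From mathcomp Require Import boolp classical_sets reals complex.

Set Implicit Arguments.
Unset Strict Implicit.
Unset Printing Implicit Defensive.

Import GRing.Theory.
Local Open Scope ring_scope.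

Section LinearAlgebra.
Variable K : fieldType.

Lemma finite_spanning_set (V : vectType K) (P : set V) :
  exists s : seq V, (forall x, x \in s -> P x) /\
                    (forall x, P x -> x \in <<s>>%VS).
Proof.
pose ok (s : seq V) := forall x, x \in s -> P x.
have H d : forall s, ok s -> (\dim {:V} - \dim <<s>> <= d)%N ->
    exists s', ok s' /\ forall x, P x -> x \in <<s'>>%VS.
  elim: d => [|d IHd] s oks les.
    exists s; split=> // x _.
    suff -> : <<s>>%VS = fullv by rewrite memvf.
    by apply/eqP; rewrite eqEdim subvf -subn_eq0 -leqn0.
  case: (pselect (forall x, P x -> x \in <<s>>%VS)) => [allin|]; first by exists s.
  move=> /existsNP[x] /not_implyP[Px /negP xs].
  apply: (IHd (x :: s)) => [y|].
    by rewrite inE => /orP[/eqP->|/oks].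
  have lt : (\dim <<s>> < \dim <<x :: s>>)%N.
    have sub : (<<s>> <= <<x :: s>>)%VS.
      by apply: sub_span => y ys; rewrite inE ys orbT.
    rewrite ltn_neqAle (dimvS sub) andbT.
    apply: contra xs => eqd.
    by rewrite (eqP (_ : <<s>>%VS == <<x :: s>>%VS)) ?memv_span ?mem_head //
       eqEdim sub (eqP eqd) leqnn.
  rewrite -ltnS (leq_trans _ les) // ltn_sub2l //.
  exact: leq_trans lt (dimvS (subvf _)).
by apply: (H _ [::] _ (leqnn _)) => x.
Qed.

Definition vspan (V : vectType K) (P : set V) : {vspace V} :=
  <<sval (cid (finite_spanning_set P))>>%VS.

Lemma mem_vspan (V : vectType K) (P : set V) (x : V) : P x -> x \in vspan P.
Proof. by rewrite /vspan; case: cid => s [_ H] /= /H. Qed.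

Lemma vspan_sub (V : vectType K) (P : set V) (U : {vspace V}) :
  (forall x, P x -> x \in U) -> (vspan P <= U)%VS.
Proof.
by rewrite /vspan; case: cid => s [H _] /= PU; apply/span_subvP => x /H /PU.
Qed.

Definition dual (V : vectType K) := 'Hom(V, K^o).

Definition lfun_trace (V : vectType K) (f : 'End(V)) : K :=
  \sum_(k < \dim {:V}) coord (vbasis {:V}) k (f (vbasis {:V})`_k).

(* For finite-dimensional U and V, the canonical isomorphism identifies U ⊗ V *)
(* with Hom(U^*, V), the pure tensor u ⊗ v being phi |-> phi(u) v.            *)
Definition tensor (U V : vectType K) := 'Hom(dual U, V).

Definition pure_fun (U V : vectType K) (u : U) (v : V) (phi : dual U) : V :=
  (phi u : K) *: v.

Fact pure_fun_is_linear (U V : vectType K) (u : U) (v : V) :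
  linear (pure_fun u v).
Proof.
by move=> c phi psi; rewrite /pure_fun add_lfunE scale_lfunE scalerDl -scalerA.
Qed.

HB.instance Definition _ (U V : vectType K) (u : U) (v : V) :=
  GRing.isLinear.Build K (dual U) V _ (pure_fun u v) (pure_fun_is_linear u v).

Definition pure (U V : vectType K) (u : U) (v : V) : tensor U V :=
  linfun (pure_fun u v).

Definition precomp_fun (U U' : vectType K) (f : 'Hom(U, U')) (phi : dual U') :
  dual U := (phi \o f)%VF.

Fact precomp_fun_is_linear (U U' : vectType K) (f : 'Hom(U, U')) :
  linear (precomp_fun f).
Proof. by move=> c phi psi; rewrite /precomp_fun comp_lfunDl comp_lfunZl. Qed.

HB.instance Definition _ (U U' : vectType K) (f : 'Hom(U, U')) :=
  GRing.isLinear.Build K (dual U') (dual U) _ (precomp_fun f)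
    (precomp_fun_is_linear f).

(* f ⊗ g, see tensor_map_pure *)
Definition tensor_map (U V U' V' : vectType K)
    (f : 'Hom(U, U')) (g : 'Hom(V, V')) (t : tensor U V) : tensor U' V' :=
  (g \o t \o linfun (precomp_fun f))%VF.

Lemma tensor_map_pure (U V U' V' : vectType K)
    (f : 'Hom(U, U')) (g : 'Hom(V, V')) (u : U) (v : V) :
  tensor_map f g (pure u v) = pure (f u) (g v).
Proof.
apply/lfunP => phi.
by rewrite !comp_lfunE !lfunE /= /pure_fun /precomp_fun comp_lfunE linearZ.
Qed.

Definition tensor_sub (U V : vectType K) (A : {vspace U}) (B : {vspace V}) :
    {vspace tensor U V} :=
  vspan [set t | exists u v, [/\ u \in A, v \in B & t = pure u v]].

End LinearAlgebra.

HB.mixin Record isLieAlgebra (K : fieldType) (V : Type) of Vector K V := {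
  lie : V -> V -> V;
  lie_linearl : forall y, linear (fun x => lie x y);
  lie_linearr : forall x, linear (lie x);
  lie_alt : forall x, lie x x = 0;
  lie_jacobi : forall x y z,
    lie x (lie y z) + lie y (lie z x) + lie z (lie x y) = 0
}.

#[short(type="lieAlgType")]
HB.structure Definition LieAlgebra (K : fieldType) :=
  { V of isLieAlgebra K V & Vector K V }.

HB.instance Definition _ (K : fieldType) (g : lieAlgType K) (x : g) :=
  GRing.isLinear.Build K g g _ (lie x) (lie_linearr x).

Section LieTheory.
Variables (K : fieldType) (g : lieAlgType K).
Implicit Types (U V b : {vspace g}) (x y : g).

Definition ad x : 'End(g) := linfun (lie x).

Definition killing x y : K := lfun_trace (ad x \o ad y)%VF.

Definition lie_prod U V : {vspace g} :=
  vspan [set z | exists x y, [/\ x \in U, y \in V & z = lie x y]].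

Definition subalgebra U : Prop := (lie_prod U U <= U)%VS.

Definition lie_ideal U : Prop := (lie_prod fullv U <= U)%VS.

Definition simple_lie : Prop :=
  (exists x y, lie x y <> 0) /\
  (forall U, lie_ideal U -> U = 0%VS \/ U = fullv).

Definition solvable_lie U : Prop :=
  exists k : nat, iter k (fun V => lie_prod V V) U = 0%VS.

Definition borel b : Prop :=
  [/\ subalgebra b, solvable_lie b &
      forall U, subalgebra U -> solvable_lie U -> (b <= U)%VS -> U = b].

Definition centre U : {vspace g} :=
  vspan [set x | x \in U /\ forall y, y \in U -> lie x y = 0].

Definition ad_diagonalizable x : Prop :=
  exists e : seq g, basis_of fullv e /\
    forall v, v \in e -> exists c : K, ad x v = c *: v.

(* The usual definition of a Cartan subalgebra of a complex semisimple Lie    *)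
(* algebra: self-centralizing commutative subspace of ad-diagonalizable       *)
(* elements.                                                                  *)
Definition cartan_subalgebra (h : {vspace g}) : Prop :=
  [/\ forall x y, x \in h -> y \in h -> lie x y = 0,
      forall x, (forall y, y \in h -> lie y x = 0) -> x \in h &
      forall x, x \in h -> ad_diagonalizable x].

End LieTheory.

Section Roots.
Variables (K : fieldType) (g : lieAlgType K) (h : {vspace g}).

Definition weight := dual (subvs_of h).

Definition root_space (a : weight) : {vspace g} :=
  vspan [set x | forall H : subvs_of h, lie (vsval H) x = (a H : K) *: x].

Definition lie_root (a : weight) : Prop := a != 0 /\ root_space a != 0%VS.

Definition root_sum (P : weight -> Prop) : {vspace g} :=
  vspan [set x | exists a, [/\ lie_root a, P a & x \in root_space a]].

(* The element t_a of h with killing t_a H = a H for all H in h; it exists    *)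
(* and is unique when g is semisimple.                                        *)
Definition killing_dual (a : weight) : subvs_of h :=
  xget 0 [set t | forall H : subvs_of h,
                    killing (vsval t) (vsval H) = (a H : K)].

Definition weight_form (a b : weight) : K :=
  killing (vsval (killing_dual a)) (vsval (killing_dual b)).

Definition cartan_integer (a b : weight) : K :=
  2 * weight_form a b / weight_form b b.

Section Base.
Variables (n : nat) (Pi : n.-tuple weight).

Definition nonneg_comb (a : weight) : Prop :=
  exists c : 'I_n -> nat, a = \sum_(k < n) tnth Pi k *+ c k.

Definition positive_root (a : weight) : Prop := lie_root a /\ nonneg_comb a.

Definition root_base : Prop :=
  [/\ free Pi, forall k, lie_root (tnth Pi k) &
      forall a, lie_root a -> nonneg_comb a \/ nonneg_comb (- a)].

(* Pi is the set of simple roots of the positive system determined by b *)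
Definition simple_roots_of (b : {vspace g}) : Prop :=
  root_base /\
  forall a, lie_root a -> (positive_root a <-> (root_space a <= b)%VS).

Variable q : 'I_n.

Definition levi_root (a : weight) : Prop :=
  a \in <<[seq tnth Pi k | k <- enum 'I_n & k != q]>>%VS.

Definition levi : {vspace g} := (h + root_sum levi_root)%VS.

Definition nilrad : {vspace g} :=
  root_sum (fun a => positive_root a /\ ~ levi_root a).

Definition opp_nilrad : {vspace g} :=
  root_sum (fun a => positive_root (- a) /\ ~ levi_root (- a)).

Definition grade (j : int) : {vspace g} :=
  (root_sum (fun a => coord Pi q a = j%:~R :> K) +
   (if (j == 0)%R then h else 0))%VS.

Definition quasi_heisenberg : Prop :=
  lie_prod nilrad (lie_prod nilrad nilrad) = 0%VS /\
  (1 < \dim (lie_prod nilrad nilrad))%N.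

End Base.
End Roots.

Definition omega (K : fieldType) (g : lieAlgType K) (m : nat)
    (X Xs : m.-tuple g) : tensor g g :=
  \sum_(j < m) pure (tnth Xs j) (tnth X j).

Definition dual_bases (K : fieldType) (g : lieAlgType K) (U V : {vspace g})
    (m : nat) (X Xs : m.-tuple g) : Prop :=
  [/\ basis_of U X, basis_of V Xs &
      forall j k, killing (tnth X j) (tnth Xs k) = (j == k)%:R].

Definition tau2 (K : fieldType) (g : lieAlgType K) (w : tensor g g)
    (X : g) : tensor g g :=
  2^-1 *: tensor_map (ad X \o ad X)%VF \1%VF w.

Inductive dynkin :=
  | TypeA of nat | TypeB of nat | TypeC of nat | TypeD of nat
  | TypeE6 | TypeE7 | TypeE8 | TypeF4 | TypeG2.

Definition rank_of (T : dynkin) : nat :=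
  match T with
  | TypeA n | TypeB n | TypeC n | TypeD n => n
  | TypeE6 => 6 | TypeE7 => 7 | TypeE8 => 8 | TypeF4 => 4 | TypeG2 => 2
  end.

Definition chain_edge (i j : nat) : bool := (j == i.+1) || (i == j.+1).

Definition edge_in (s : seq (nat * nat)) (i j : nat) : bool :=
  ((i, j) \in s) || ((j, i) \in s).

Definition adjacent (T : dynkin) (i j : nat) : bool :=
  match T with
  | TypeD n => [&& chain_edge i j, i != n & j != n] || edge_in [:: (n.-2, n)] i j
  | TypeE6 | TypeE7 | TypeE8 =>
      edge_in [:: (1, 3); (3, 4); (2, 4); (4, 5); (5, 6); (6, 7); (7, 8)] i j
  | _ => chain_edge i j
  end%N.

(* The pair (i, j) for which the Cartan integer 2(a_i,a_j)/(a_j,a_j) is not   *)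
(* 0, -1 or 2: a_i is then the long root of a multiple bond.                  *)
Definition multiple_bond (T : dynkin) : option (nat * nat * int) :=
  match T with
  | TypeB n => Some (n.-1, n, -2)
  | TypeC n => Some (n, n.-1, -2)
  | TypeF4 => Some (2%N, 3%N, -2)
  | TypeG2 => Some (2%N, 1%N, -3)
  | _ => None
  end.

(* Entry 2(a_i,a_j)/(a_j,a_j) of the Cartan matrix of type T, for the         *)
(* Bourbaki labels 1 <= i, j <= rank_of T of the simple roots.                *)
Definition cartan_entry (T : dynkin) (i j : nat) : int :=
  if i == j then 2
  else if ~~ adjacent T i j then 0
  else if multiple_bond T is Some (i0, j0, c) then
         if (i == i0) && (j == j0) then c else -1
  else -1.

(* The simple root with Bourbaki label k is entry k - 1 of Pi. *)
Definition has_type (K : fieldType) (g : lieAlgType K) (h : {vspace g})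
    (T : dynkin) (Pi : (rank_of T).-tuple (weight h)) : Prop :=
  forall i j : 'I_(rank_of T),
    cartan_integer (tnth Pi i) (tnth Pi j) = (cartan_entry T i.+1 j.+1)%:~R.

Definition listed_type (T : dynkin) (i : nat) : bool :=
  match T with
  | TypeB n => (3 <= i <= n)%N
  | TypeC n => (2 <= i <= n - 1)%N
  | TypeD n => (3 <= i <= n - 3)%N
  | TypeE6 => (i == 3%N) || (i == 5%N)
  | TypeE7 => (i == 2%N) || (i == 6%N)
  | TypeE8 => i == 1%N
  | TypeF4 => i == 4%N
  | _ => false
  end.

(* Main.v *)
Require Import Defs.
From HB Require Import structures.
From mathcomp Require Import all_boot all_order all_algebra.
From mathcomp Require Import boolp classical_sets reals complex.

Set Implicit Arguments.
Unset Strict Implicit.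
Unset Printing Implicit Defensive.

Import GRing.Theory Num.Theory.
Local Open Scope ring_scope.

(** Let [H] in [h] be the element with [a H] the coefficient of [alpha_q] in [a];
    the eigenspaces [geig c] of [ad H] are the graded pieces g(c). The Killing
    form is nonzero, since it takes a nonzero value on a coroot, hence it is
    nondegenerate by simplicity. Because the parabolic is maximal, every trace
    form on g(0) is a multiple of [killing H]. So if a sum of graded pieces is
    stable under y in g(c) and z in g(-c) with [killing y z <> 0] and [c <> 0],
    then [ad H] has trace zero on it. Applied to well-chosen sums, this shows
    that g(1) generates n, whence g(j) = 0 for |j| > 2, and that g(-2) is the
    centre of the opposite nilradical, whence the values of tau_2. Finally take
    noncommuting root vectors x, y in g(1) with roots a, b, and f in g(-2) of
    weight -a-b paired with [x, y]: if ad(Y)^2 f vanished for every Y in g(1),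
    polarisation would give t_a = t_b, i.e. a = b; but [g_a, g_a] = 0. *)

(** * Traces and projections onto sums of eigenspaces *)

Section Traces.
Variables (K : fieldType) (V : vectType K).
Implicit Types (f : 'End(V)) (x : V).

Lemma vspan_ind (P : set V) (U : {vspace V}) x :
  x \in vspan P -> (forall y, P y -> y \in U) -> x \in U.
Proof. by move=> xP PU; apply: subvP (vspan_sub PU) _ xP. Qed.

Lemma lfun_basis_ext (W : vectType K) n (e : n.-tuple V) (f1 f2 : 'Hom(V, W)) :
  basis_of fullv e -> (forall k : 'I_n, f1 e`_k = f2 e`_k) -> f1 = f2.
Proof.
move=> be fe; apply/lfunP => x; rewrite (coord_basis be (memvf x)).
by rewrite !linear_sum; apply: eq_bigr => k _; rewrite !linearZ /= fe.
Qed.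

(** Both sides equal one double sum over products of coordinates in the two bases. This allows
    traces to be computed in an eigenbasis. *)
Lemma lfun_traceE n (e : n.-tuple V) f : basis_of fullv e ->
  lfun_trace f = \sum_(k < n) coord e k (f e`_k).
Proof.
move=> be; rewrite /lfun_trace; set b := vbasis _.
have bb : basis_of fullv b by exact: vbasisP.
transitivity (\sum_(i < _) \sum_(k < n) coord e k b`_i * coord b i (f e`_k)).
  apply: eq_bigr => i _.
  rewrite {1}(coord_basis be (memvf b`_i)) !linear_sum.
  by apply: eq_bigr => k _; rewrite !linearZ.
rewrite exchange_big; apply: eq_bigr => k _ /=.
rewrite {2}(coord_basis bb (memvf (f e`_k))) linear_sum.
by apply: eq_bigr => i _; rewrite linearZ mulrC.
Qed.

Lemma lfun_trace_is_linear : scalar (@lfun_trace K V).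
Proof.
move=> c f1 f2; rewrite /lfun_trace mulr_sumr -big_split.
by apply: eq_bigr => k _; rewrite add_lfunE scale_lfunE linearP.
Qed.

HB.instance Definition _ :=
  GRing.isLinear.Build K 'End(V) K^o _ (@lfun_trace K V) lfun_trace_is_linear.

Lemma lfun_traceB f1 f2 : lfun_trace (f1 - f2) = lfun_trace f1 - lfun_trace f2.
Proof. exact: linearB. Qed.

Lemma lfun_traceC (a b : 'End(V)) :
  lfun_trace (a \o b)%VF = lfun_trace (b \o a)%VF.
Proof.
set e := vbasis {:V}; have be : basis_of fullv e by exact: vbasisP.
have H (u v : 'End(V)) : lfun_trace (u \o v)%VF =
    \sum_(i < _) \sum_(k < _) coord e k (v e`_i) * coord e i (u e`_k).
  apply: eq_bigr => i _.
  rewrite comp_lfunE {1}(coord_basis be (memvf (v _))) !linear_sum.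
  by apply: eq_bigr => k _; rewrite !linearZ.
rewrite !H exchange_big; apply: eq_bigr => i _; apply: eq_bigr => k _.
by rewrite mulrC.
Qed.

(** The hypotheses say that the image of the projection [p] is stable under [a] and [b], so the
    commutator restricts there to a commutator of restrictions. *)
Lemma lfun_trace_stable (p a b : 'End(V)) :
  (p \o p = p)%VF -> (p \o a \o p = a \o p)%VF -> (p \o b \o p = b \o p)%VF ->
  lfun_trace (p \o ((a \o b) - (b \o a)))%VF = 0.
Proof.
move=> pp pa pb.
have H (u v : 'End(V)) : (p \o u \o p = u \o p)%VF -> (p \o v \o p = v \o p)%VF ->
    lfun_trace (p \o (u \o v))%VF = lfun_trace ((u \o p) \o (v \o p))%VF.
  move=> pu pv; rewrite -[X in (X \o _)%VF]pp -comp_lfunA lfun_traceC.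
  by rewrite -pu -!comp_lfunA (comp_lfunA p v) pv.
rewrite comp_lfunDr comp_lfunNr linearB /=.
by rewrite !H // lfun_traceC subrr.
Qed.

(** Reflexivity in finite dimension; it later turns the coefficient functional on weights into an
    element of the Cartan subalgebra. *)
Lemma dual_evaluation (F : dual (dual V)) :
  exists v : V, forall phi : dual V, phi v = F phi.
Proof.
set b := vbasis {:V}; have bb : basis_of fullv b by exact: vbasisP.
pose cb i : dual V := linfun (coord b i : V -> K^o).
exists (\sum_(i < _) (F (cb i) : K) *: b`_i) => phi.
have cbE i (k : 'I_(\dim {:V})) : cb i b`_k = (i == k)%:R.
  by rewrite lfunE /= coord_free ?(basis_free bb) // eq_sym.
have sumE (c : 'I_(\dim {:V}) -> K) (k : 'I_(\dim {:V})) :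
    (\sum_(i < _) c i *: cb i) b`_k = c k.
  rewrite sum_lfunE (bigD1 k) //= big1 => [|i ik]; rewrite scale_lfunE cbE.
    by rewrite eqxx addr0; apply: mulr1.
  by rewrite (negPf ik); apply: mulr0.
have -> : phi = \sum_(i < _) (phi b`_i : K) *: cb i.
  by apply: (lfun_basis_ext bb) => k; rewrite sumE.
rewrite !linear_sum; apply: eq_bigr => i _.
by rewrite !linearZ /= sumE; apply: mulrC.
Qed.

Section Eigenbasis.

Definition eigenbasis (D : 'End(V)) n (e : n.-tuple V) (c : 'I_n -> K) :=
  basis_of fullv e /\ forall k : 'I_n, D e`_k = c k *: e`_k.

(** For an eigenbasis, this is the projection onto the sum of the eigenspaces with eigenvalue in
    [I], along the other eigenspaces. *)
Definition eigproj_fun n (e : n.-tuple V) (c : 'I_n -> K) (I : pred K) (x : V) :=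
  \sum_(k < n | I (c k)) coord e k x *: e`_k.

Fact eigproj_fun_is_linear n (e : n.-tuple V) (c : 'I_n -> K) (I : pred K) :
  linear (eigproj_fun e c I).
Proof.
move=> l x y; rewrite /eigproj_fun scaler_sumr -big_split.
by apply: eq_bigr => k _; rewrite linearP scalerDl scalerA.
Qed.

HB.instance Definition _ n (e : n.-tuple V) (c : 'I_n -> K) (I : pred K) :=
  GRing.isLinear.Build K V V _ (eigproj_fun e c I) (eigproj_fun_is_linear e c I).

Definition eigproj n (e : n.-tuple V) (c : 'I_n -> K) (I : pred K) : 'End(V) :=
  linfun (eigproj_fun e c I).

Variables (D : 'End(V)) (n : nat) (e : n.-tuple V) (c : 'I_n -> K).
Hypothesis eD : eigenbasis D e c.
Implicit Type I : pred K.

Lemma coord_eigenbasis k x : coord e k (D x) = c k * coord e k x.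
Proof.
case: eD => be De; have fe := basis_free be.
rewrite {1}(coord_basis be (memvf x)) linear_sum.
under eq_bigr do rewrite linearZ /= De scalerA.
by rewrite coord_sum_free // mulrC.
Qed.

Lemma coord_eigenvector k x l :
  D x = l *: x -> coord e k x != 0 -> c k = l.
Proof.
move=> Dx nz; have := coord_eigenbasis k x; rewrite Dx linearZ /=.
by move/(mulIf nz).
Qed.

Lemma eigproj_eigenvector I x l :
  D x = l *: x -> eigproj e c I x = (I l)%:R *: x.
Proof.
move=> Dx; rewrite lfunE /= /eigproj_fun.
rewrite {2}(coord_basis eD.1 (memvf x)) scaler_sumr big_mkcond.
apply: eq_bigr => k _; have [->|nz] := eqVneq (coord e k x) 0.
  by rewrite scale0r scaler0 if_same.
by rewrite (coord_eigenvector Dx nz); case: (I l); rewrite ?scale1r ?scale0r.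
Qed.

Lemma eigproj_basis I (k : 'I_n) : eigproj e c I e`_k = (I (c k))%:R *: e`_k.
Proof. exact/eigproj_eigenvector/eD.2. Qed.

Lemma eigproj_idem I : (eigproj e c I \o eigproj e c I = eigproj e c I)%VF.
Proof.
apply: (lfun_basis_ext eD.1) => k.
rewrite comp_lfunE eigproj_basis linearZ /= eigproj_basis scalerA.
by case: (I _); rewrite ?mul1r ?mul0r.
Qed.

Lemma eigproj_stable I (a : 'End(V)) :
  (forall k : 'I_n, I (c k) -> eigproj e c I (a e`_k) = a e`_k) ->
  (eigproj e c I \o a \o eigproj e c I = a \o eigproj e c I)%VF.
Proof.
move=> aI; apply: (lfun_basis_ext eD.1) => k; rewrite !comp_lfunE.
rewrite eigproj_basis !linearZ /=.
by case: (boolP (I (c k))) => [/aI->//|_]; rewrite !scale0r.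
Qed.

Lemma eigproj_comm I (a : 'End(V)) :
  (D \o a = a \o D)%VF -> (eigproj e c I \o a = a \o eigproj e c I)%VF.
Proof.
move=> Da; apply: (lfun_basis_ext eD.1) => k; rewrite !comp_lfunE.
rewrite eigproj_basis linearZ /=; apply: eigproj_eigenvector.
by rewrite -comp_lfunE Da comp_lfunE eD.2 linearZ.
Qed.

Lemma eigproj_pred1 l x :
  D (eigproj e c (pred1 l) x) = l *: eigproj e c (pred1 l) x.
Proof.
rewrite lfunE /= /eigproj_fun linear_sum scaler_sumr.
by apply: eq_bigr => k /eqP <-; rewrite linearZ /= eD.2 !scalerA mulrC.
Qed.

Lemma eigproj_span x (U : {vspace V}) :
  (forall l, eigproj e c (pred1 l) x \in U) -> x \in U.
Proof.
(* Each eigenvalue must be listed once, since every projection already collects the whole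
   eigenspace. *)
move=> xU; have -> : x = \sum_(l <- undup (codom c)) eigproj e c (pred1 l) x.
  suff -> : \sum_(l <- undup (codom c)) eigproj e c (pred1 l) x =
      (\sum_(l <- undup (codom c)) eigproj e c (pred1 l)) x.
    rewrite -{1}(id_lfunE x); congr (fun_of_lfun _ x).
    apply: (lfun_basis_ext eD.1) => k; rewrite id_lfunE sum_lfunE.
    rewrite (bigD1_seq (c k)) ?undup_uniq ?mem_undup ?codom_f //=.
    rewrite eigproj_basis /= eqxx scale1r big1 ?addr0 // => l nl.
    by rewrite eigproj_basis /= eq_sym (negPf nl) scale0r.
  by rewrite sum_lfunE.
by apply: rpred_sum => l _.
Qed.

Lemma trace_eigproj I : lfun_trace (eigproj e c I \o D)%VF =
  \sum_(k | I (c k)) c k.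
Proof.
rewrite (lfun_traceE _ eD.1) [RHS]big_mkcond; apply: eq_bigr => k _.
rewrite comp_lfunE eD.2 linearZ /= eigproj_basis !linearZ /=.
rewrite coord_free ?(basis_free eD.1) // eqxx mulr1.
by case: (I _); rewrite ?mulr1 ?mulr0.
Qed.

End Eigenbasis.
End Traces.

(** * Brackets, invariance and nondegeneracy of the Killing form *)

Section LieBasics.
Variables (K : fieldType) (g : lieAlgType K).
Implicit Types x y z : g.

Lemma adE x y : ad x y = lie x y.
Proof. by rewrite lfunE. Qed.

Lemma lieC x y : lie x y = - lie y x.
Proof.
have D u v w : lie (u + v) w = lie u w + lie v w.
  by have := lie_linearl w 1 u v; rewrite !scale1r.
have := lie_alt (x + y); rewrite D !linearD /= !lie_alt add0r addr0.
by move/eqP; rewrite addr_eq0 => /eqP.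
Qed.

(* [- ad y] packages right multiplication by [y] as a linear map. *)
Lemma lie_adr x y : lie x y = (- ad y) x.
Proof. by rewrite opp_lfunE adE -lieC. Qed.

Lemma lieDl x y z : lie (x + y) z = lie x z + lie y z.
Proof. by rewrite !lie_adr linearD. Qed.

Lemma lieZl c x z : lie (c *: x) z = c *: lie x z.
Proof. by rewrite !lie_adr linearZ. Qed.

Lemma lie0l x : lie 0 x = 0. Proof. by rewrite lie_adr linear0. Qed.

Lemma lieNl x y : lie (- x) y = - lie x y.
Proof. by rewrite !lie_adr linearN. Qed.

Lemma lieZr c x z : lie x (c *: z) = c *: lie x z.
Proof. by rewrite linearZ. Qed.

Lemma lie_der x y z : lie x (lie y z) = lie (lie x y) z + lie y (lie x z).
Proof.
have /eqP := lie_jacobi x y z.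
rewrite (lieC z x) (lieC z (lie x y)) linearN /= => /eqP J.
by apply/eqP; rewrite -subr_eq0 opprD addrA addrAC; apply/eqP.
Qed.

Lemma ad_lie x y : ad (lie x y) = ((ad x \o ad y) - (ad y \o ad x))%VF.
Proof.
apply/lfunP => z; rewrite !(add_lfunE, opp_lfunE, comp_lfunE, adE).
by rewrite lie_der addrK.
Qed.

Lemma ad_is_linear : linear (@ad K g).
Proof.
move=> c x y; apply/lfunP => z.
by rewrite !(add_lfunE, scale_lfunE, adE) lieDl lieZl.
Qed.

HB.instance Definition _ :=
  GRing.isLinear.Build K g 'End(g) _ (@ad K g) ad_is_linear.

Lemma killingC x y : killing x y = killing y x.
Proof. exact: lfun_traceC. Qed.

Lemma killing_is_linear x : scalar (killing x).
Proof.
move=> c y z; rewrite /killing linearP comp_lfunDr -comp_lfunZr.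
exact: lfun_trace_is_linear.
Qed.

HB.instance Definition _ x :=
  GRing.isLinear.Build K g K^o _ (killing x) (killing_is_linear x).

(** Turns orthogonality to [x] into membership in a kernel, so that it can be checked on spanning
    sets. *)
Definition killf x : dual g := linfun (killing x : g -> K^o).

Lemma killfE x y : killf x y = killing x y. Proof. by rewrite lfunE. Qed.

Lemma memv_killf x y : (x \in lker (killf y)) = (killing y x == 0).
Proof. by rewrite memv_ker killfE. Qed.

Lemma killingZl c x y : killing (c *: x) y = c * killing x y.
Proof. by rewrite killingC linearZ killingC. Qed.

Lemma killingZr c x y : killing x (c *: y) = c * killing x y.
Proof. by rewrite linearZ. Qed.

Lemma killing0r x : killing x 0 = 0.
Proof. exact: linear0. Qed.

Lemma killingDl x y z : killing (x + y) z = killing x z + killing y z.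
Proof. by rewrite killingC linearD /= !(killingC z). Qed.

Lemma killingBl x y z : killing (x - y) z = killing x z - killing y z.
Proof. by rewrite killingC linearB /= !(killingC z). Qed.

Lemma killing_invariant x y z : killing (lie x y) z = killing x (lie y z).
Proof.
rewrite /killing !ad_lie comp_lfunDl comp_lfunDr comp_lfunNl comp_lfunNr.
by rewrite !lfun_traceB -!comp_lfunA (lfun_traceC (ad y)) -comp_lfunA.
Qed.

Lemma mem_lie_prod (U V : {vspace g}) x y :
  x \in U -> y \in V -> lie x y \in lie_prod U V.
Proof. by move=> xU yV; apply: mem_vspan; exists x, y. Qed.

Lemma lie_prodS (U V U' V' : {vspace g}) :
  (U <= U')%VS -> (V <= V')%VS -> (lie_prod U V <= lie_prod U' V')%VS.
Proof.
move=> UU' VV'; apply: vspan_sub => _ [x [y [xU yV ->]]].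
by apply: mem_lie_prod; [apply: (subvP UU') | apply: (subvP VV')].
Qed.

Lemma lie_prod0r (U : {vspace g}) : lie_prod U 0%VS = 0%VS.
Proof.
apply/eqP; rewrite -subv0; apply: vspan_sub => _ [x [y [_ + ->]]].
by rewrite (memv0 y) => /eqP ->; rewrite linear0 mem0v.
Qed.

Lemma mem_centre (U : {vspace g}) x :
  x \in centre U <-> x \in U /\ forall y, y \in U -> lie x y = 0.
Proof.
split=> [xc|]; last exact: mem_vspan.
split=> [|y yU]; first by apply: vspan_ind xc _ => y [].
suff: x \in lker (ad y) by rewrite memv_ker adE lieC oppr_eq0 => /eqP.
apply: vspan_ind xc _ => z [_ /(_ _ yU) zy].
by rewrite memv_ker adE lieC zy oppr0.
Qed.

(** The map from [g] to its dual given by the Killing form, read through a basis as an endomorphism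
    of [g], so that injectivity yields surjectivity. *)
Definition killing_coord x : g :=
  \sum_(i < \dim {:g}) killing x (vbasis {:g})`_i *: (vbasis {:g})`_i.

Fact killing_coord_is_linear : linear killing_coord.
Proof.
move=> c x y; rewrite /killing_coord scaler_sumr -big_split.
by apply: eq_bigr => i _; rewrite killingDl killingZl scalerDl scalerA.
Qed.

HB.instance Definition _ :=
  GRing.isLinear.Build K g g _ killing_coord killing_coord_is_linear.

Section Simple.
Hypothesis simple_g : simple_lie g.

(** The centre is an ideal, and it is proper because some bracket is nonzero. *)
Lemma simple_centerless x : (forall y, lie y x = 0) -> x = 0.
Proof.
move=> xC; pose Z := vspan [set z : g | forall y, lie y z = 0].
have ZP z : z \in Z -> forall y, lie y z = 0.
  move=> zZ y; suff: z \in lker (ad y) by rewrite memv_ker adE => /eqP.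
  by apply: vspan_ind zZ _ => t ty; rewrite memv_ker adE ty.
have [Z0|ZT] : Z = 0%VS \/ Z = fullv.
- apply: simple_g.2; apply: vspan_sub => _ [u [v [_ vZ ->]]].
  by rewrite ZP // mem0v.
- by apply/eqP; rewrite -memv0 -Z0; apply: mem_vspan.
- case: simple_g.1 => u [v []]; apply: ZP; rewrite ZT; exact: memvf.
Qed.

Hypothesis killing_neq0 : exists x y : g, killing x y <> 0.

(** By invariance the radical of the form is an ideal, and it is proper because the form is
    nonzero. *)
Lemma killing_nondegenerate x : (forall y, killing x y = 0) -> x = 0.
Proof.
move=> xR; pose Z := vspan [set z : g | forall y, killing z y = 0].
have ZP z : z \in Z -> forall y, killing z y = 0.
  move=> zZ y; rewrite killingC; apply/eqP; rewrite -memv_killf.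
  by apply: vspan_ind zZ _ => t ty; rewrite memv_killf killingC ty.
have [Z0|ZT] : Z = 0%VS \/ Z = fullv.
- apply: simple_g.2; apply: vspan_sub => _ [u [v [_ vZ ->]]].
  apply: mem_vspan => y; rewrite lieC -scaleN1r killingZl killing_invariant.
  by rewrite ZP // mulr0.
- by apply/eqP; rewrite -memv0 -Z0; apply: mem_vspan.
- case: killing_neq0 => u [v []]; apply: ZP; rewrite ZT; exact: memvf.
Qed.

Lemma killing_representation (phi : dual g) :
  exists z, forall y, killing z y = phi y.
Proof.
set b := vbasis {:g}; have bb : basis_of fullv b by exact: vbasisP.
have coordF i x : coord b i (linfun killing_coord x) = killing x b`_i.
  by rewrite lfunE /= coord_sum_free ?(basis_free bb).
have kerF : lker (linfun killing_coord) == 0%VS.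
  rewrite -subv0; apply/subvP => x; rewrite memv_ker memv0 => /eqP Fx.
  apply/eqP/killing_nondegenerate => y; rewrite (coord_basis bb (memvf y)).
  rewrite linear_sum /= big1 // => i _.
  by rewrite killingZr -coordF Fx linear0 mulr0.
pose w := \sum_(i < \dim {:g}) (phi b`_i : K) *: b`_i.
have [z zw] : exists z, linfun killing_coord z = w.
  by exists ((linfun killing_coord)^-1%VF w); rewrite lker0_lfunVK.
exists z => y; rewrite (coord_basis bb (memvf y)) !linear_sum /=.
apply: eq_bigr => i _; rewrite killingZr linearZ /= -coordF zw.
by rewrite coord_sum_free ?(basis_free bb).
Qed.

(** If [x] lay outside [S], some functional vanishing on [S] would be nonzero at [x], and the
    Killing form represents it. *)
Lemma killing_double_perp (S : {vspace g}) x :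
  (forall z, (forall s, s \in S -> killing z s = 0) -> killing z x = 0) ->
  x \in S.
Proof.
move=> xS; have [//|nxS] := boolP (x \in S).
pose y := x - projv S x.
have y0 : y != 0.
  by apply: contra nxS; rewrite subr_eq0 => /eqP ->; apply: memv_proj.
have [i yi] : exists i, coord (vbasis {:g}) i y != 0.
  apply/existsP; apply: contraNT y0 => /existsPn y0.
  rewrite (coord_vbasis (memvf y)) big1 // => i _.
  by move: (y0 i); rewrite negbK => /eqP ->; rewrite scale0r.
pose phi : dual g :=
  (linfun (coord (vbasis {:g}) i : g -> K^o) \o (\1 - projv S))%VF.
have [z zP] := killing_representation phi.
have phiE u : phi u = coord (vbasis {:g}) i (u - projv S u).
  by rewrite comp_lfunE lfunE /= add_lfunE opp_lfunE id_lfunE.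
move: yi; rewrite -phiE -zP xS ?eqxx // => s sS.
by rewrite zP phiE projv_id // subrr linear0.
Qed.

End Simple.
End LieBasics.

(** * Root space decomposition and its pairing under the Killing form *)

Section RootDecomposition.
Variables (K : fieldType) (g : lieAlgType K) (h : {vspace g}).
Hypothesis cartan_h : cartan_subalgebra h.
Implicit Types (x y : g) (a b : weight h) (H : subvs_of h).

Lemma root_spaceP a x :
  x \in root_space a <-> forall H, lie (vsval H) x = (a H : K) *: x.
Proof.
split=> [xa H|]; last exact: mem_vspan.
suff: x \in lker (ad (vsval H) - (a H : K) *: \1%VF).
  rewrite memv_ker add_lfunE opp_lfunE scale_lfunE id_lfunE adE subr_eq0.
  by move/eqP.
apply: vspan_ind xa _ => y ya.
by rewrite memv_ker add_lfunE opp_lfunE scale_lfunE id_lfunE adE subr_eq0 ya.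
Qed.

Lemma lie_rootP a x : a != 0 -> x \in root_space a -> x != 0 -> lie_root a.
Proof.
by move=> a0 xa x0; split=> //; apply: contra x0 => /eqP r0; rewrite -memv0 -r0.
Qed.

Lemma lie_root_space a b x y :
  x \in root_space a -> y \in root_space b -> lie x y \in root_space (a + b).
Proof.
move=> /root_spaceP xa /root_spaceP yb; apply/root_spaceP => H.
by rewrite lie_der xa yb lieZl lieZr add_lfunE scalerDl.
Qed.

Lemma mem_cartanP x : reflect (exists H, x = vsval H) (x \in h).
Proof.
apply: (iffP idP) => [xh|[H ->]]; last exact: subvsP.
by exists (vsproj h x); rewrite vsprojK.
Qed.

(** Commutativity gives one inclusion and self-centralization the other; elements of [h] can then be
    handled as weight vectors. *)
Lemma root_space0 : root_space (0 : weight h) = h.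
Proof.
apply/vspaceP => x; apply/idP/idP => [/root_spaceP x0|xh].
  case: cartan_h => _ sc _; apply: sc => _ /mem_cartanP[H ->].
  by rewrite x0 zero_lfunE scale0r.
apply/root_spaceP => H; rewrite zero_lfunE scale0r.
by case: cartan_h => ab _ _; apply: ab => //; apply: subvsP.
Qed.

Lemma cartan_eigenbasis H : exists n (e : n.-tuple g) (c : 'I_n -> K),
  eigenbasis (ad (vsval H)) e c.
Proof.
case: cartan_h => _ _ /(_ _ (subvsP H)) [e [be ev]].
have /choice[c cP] : forall k : 'I_(size e), exists c : K,
    ad (vsval H) (in_tuple e)`_k = c *: (in_tuple e)`_k.
  by move=> k; apply: ev; apply: mem_nth.
by exists (size e), (in_tuple e), c.
Qed.

(** Simultaneous diagonalization by induction on [s]: the eigencomponents for [H] of a common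
    eigenvector of the rest remain such eigenvectors, since the projections commute with [ad] of
    elements of [h]. *)
Lemma common_eigenvectors_span (s : seq (subvs_of h)) (U : {vspace g}) :
  (forall v, (forall H, H \in s -> exists c : K, lie (vsval H) v = c *: v) ->
    v \in U) ->
  forall x, x \in U.
Proof.
elim: s U => [|H s IHs] U UP x; first exact: UP.
apply: IHs => {}x xs; have [n [e [c ec]]] := cartan_eigenbasis H.
apply: (eigproj_span ec) => l; apply: UP => H'; rewrite inE => /orP[/eqP ->|].
  by exists l; rewrite -adE (eigproj_pred1 ec).
move=> /xs[d dP]; exists d; rewrite -adE -comp_lfunE.
rewrite -(eigproj_comm ec) ?comp_lfunE ?adE ?dP ?linearZ //.
apply/lfunP => y; rewrite !comp_lfunE !adE lie_der.
have [ab _ _] := cartan_h; rewrite [X in lie X _ + _]ab ?subvsP //.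
by rewrite lie0l add0r.
Qed.

(** The decomposition takes the form of an induction principle, which avoids enumerating the roots.
    A common eigenvector for a basis of [h] is a weight vector, so it lies in [h] or in a root
    space. *)
Lemma root_decomposition (U : {vspace g}) :
  (h <= U)%VS -> (forall a, lie_root a -> (root_space a <= U)%VS) ->
  forall x, x \in U.
Proof.
move=> hU rU; apply: (@common_eigenvectors_span (vbasis {:subvs_of h})) => v vP.
have [->|v0] := eqVneq v 0; first exact: mem0v.
(* Since [- ad v] sends [H] to [[H, v]], a multiple of [v], the weight is the coordinate of that
   bracket along [v]. *)
pose a : weight h := (linfun (coord [tuple v] ord0 : g -> K^o) \o
   ((- ad v)%R \o linfun (vsval : subvs_of h -> g)))%VF.
have vsvalE H : linfun (vsval : subvs_of h -> g) H = vsval H by rewrite lfunE.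
have va : v \in root_space a.
  apply/root_spaceP => H.
  have : H \in
      (((- ad v)%R \o linfun (vsval : subvs_of h -> g))%VF @^-1: <[v]>)%VS.
    apply: subvP (memvf H); rewrite -(span_basis (vbasisP {:subvs_of h})).
    apply/span_subvP => H' /vP[c cP].
    by rewrite -memv_preim comp_lfunE vsvalE -lie_adr cP memvZ ?memv_line.
  rewrite -memv_preim comp_lfunE vsvalE -lie_adr => /vlineP[c cP].
  have fv : free [tuple v] by rewrite seq1_free.
  have -> : (a H : K) = c.
    rewrite !comp_lfunE vsvalE -lie_adr cP lfunE /= linearZ /=.
    rewrite -[X in coord _ _ X]/[tuple v]`_(ord0 : 'I_1).
    by rewrite coord_free // eqxx mulr1.
  by [].
have [a0|a0] := eqVneq a 0.
  by apply: (subvP hU); rewrite -root_space0 -a0.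
exact: subvP (rU _ (lie_rootP a0 va v0)) _ va.
Qed.

Section KillingPairing.
Hypothesis killing_nondeg : forall x, (forall y, killing x y = 0) -> x = 0.

(** Moving [H] across the form by invariance gives [- a H = b H] once the pairing is nonzero. *)
Lemma killing_root_space a b x y :
  x \in root_space a -> y \in root_space b -> killing x y != 0 -> b = - a.
Proof.
move=> /root_spaceP xa /root_spaceP yb nz; apply/eqP; rewrite -addr_eq0.
apply/eqP/lfunP => H; rewrite add_lfunE zero_lfunE.
have := killing_invariant x (vsval H) y.
rewrite lieC xa yb -scaleNr killingZl killingZr => /(mulIf nz) E.
by rewrite -E addNr.
Qed.

Lemma root_space_pairing a x : x \in root_space a -> x != 0 ->
  exists2 y, y \in root_space (- a) & killing x y = 1.
Proof.
move=> xa x0.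
have [y ya nz] : exists2 y, y \in root_space (- a) & killing x y != 0.
  apply: contrapT => none; move/eqP: x0; apply; apply: killing_nondeg => y.
  apply/eqP; rewrite -memv_killf; apply: root_decomposition => [|b _].
    rewrite -root_space0; apply/subvP => z z0; rewrite memv_killf.
    apply/negPn/negP => nz; apply: none; exists z => //.
    by rewrite -(killing_root_space xa z0 nz).
  apply/subvP => z zb; rewrite memv_killf; apply/negPn/negP => nz.
  by apply: none; exists z => //; rewrite -(killing_root_space xa zb nz).
exists ((killing x y)^-1 *: y); first exact: memvZ.
by rewrite killingZr mulVf.
Qed.

Lemma lie_root_opp a : lie_root a -> lie_root (- a).
Proof.
case=> a0 r0; have := vpick0 (root_space a); rewrite (negPf r0) => /negbT p0.
have [y ya ky] := root_space_pairing (memv_pick _) p0.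
apply: (lie_rootP _ ya); first by rewrite oppr_eq0.
by apply/eqP => y0; move: ky; rewrite y0 killing0r => /esym/eqP; rewrite oner_eq0.
Qed.

Lemma lie_root_opp_mem a x y : x \in root_space a -> y \in root_space (- a) ->
  lie x y \in h.
Proof. by move=> xa ya; rewrite -root_space0 -(subrr a) lie_root_space. Qed.

(** Identifies the bracket as [killing x y] times the Killing dual of [a]. *)
Lemma killing_coroot a x y H : x \in root_space a -> y \in root_space (- a) ->
  killing (lie x y) (vsval H) = (a H : K) * killing x y.
Proof.
move=> xa /root_spaceP ya; rewrite killing_invariant lieC ya -scaleNr killingZr.
by rewrite opp_lfunE opprK.
Qed.

Lemma cartan_nondegenerate x :
  x \in h -> (forall H, killing x (vsval H) = 0) -> x = 0.
Proof.
rewrite -{1}root_space0 => x0 xh; apply/eqP/negPn/negP => nz.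
have [y] := root_space_pairing x0 nz.
rewrite oppr0 root_space0 => /mem_cartanP[H ->].
by rewrite xh => /esym/eqP; rewrite oner_eq0.
Qed.

(** Both brackets are multiples of the Killing dual of [a], by nondegeneracy of the form on [h]. *)
Lemma lie_coroot a x y x' y' :
    x \in root_space a -> y \in root_space (- a) ->
    x' \in root_space a -> y' \in root_space (- a) ->
  killing x' y' *: lie x y = killing x y *: lie x' y'.
Proof.
move=> xa ya xa' ya'; apply/eqP; rewrite -subr_eq0; apply/eqP.
apply: cartan_nondegenerate => [|H].
  by apply: memvB; apply: memvZ; apply: lie_root_opp_mem; eassumption.
rewrite killingBl !killingZl (killing_coroot _ xa ya) (killing_coroot _ xa' ya').
by rewrite mulrCA [killing x y * _]mulrCA [X in _ * X - _]mulrC subrr.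
Qed.

End KillingPairing.
End RootDecomposition.

(** * Roots are not isotropic *)

Section RootLength.
Variables (K : numFieldType) (g : lieAlgType K) (h : {vspace g}).
Hypothesis simple_g : simple_lie g.
Hypothesis cartan_h : cartan_subalgebra h.

(* If [a] vanished on [t = [x, y]], then [ad t] would commute with [ad x] and
   [ad y], hence would be a commutator on each of its own eigenspaces, so that
   all its eigenvalues would vanish. *)
Lemma root_nonisotropic (a : weight h) x y : a != 0 ->
    x \in root_space a -> y \in root_space (- a) -> killing x y != 0 ->
  forall t : subvs_of h, vsval t = lie x y -> (a t : K) != 0.
Proof.
move=> a0 xa ya nz t tE; apply/negP => /eqP at0.
have tx : lie (vsval t) x = 0 by have /root_spaceP -> := xa; rewrite at0 scale0r.
have ty : lie (vsval t) y = 0.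
  by have /root_spaceP -> := ya; rewrite opp_lfunE at0 oppr0 scale0r.
have [n [e [c ec]]] := cartan_eigenbasis cartan_h t.
have comm z : lie (vsval t) z = 0 ->
    (ad (vsval t) \o ad z = ad z \o ad (vsval t))%VF.
  by move=> tz; apply/lfunP => u; rewrite !comp_lfunE !adE lie_der tz lie0l add0r.
have stable z : lie (vsval t) z = 0 -> forall I : pred K,
    (eigproj e c I \o ad z \o eigproj e c I = ad z \o eigproj e c I)%VF.
  move=> tz I; rewrite (eigproj_comm ec _ (comm _ tz)).
  by rewrite -comp_lfunA (eigproj_idem ec).
have c0 k : c k = 0.
  have := trace_eigproj ec (pred1 (c k)).
  rewrite tE ad_lie lfun_trace_stable ?stable ?(eigproj_idem ec) //=.
  rewrite (eq_bigr (fun=> c k)) => [|i /eqP //].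
  rewrite sumr_const => /esym/eqP; rewrite -mulr_natr mulf_eq0 pnatr_eq0.
  case/orP => [/eqP //|/eqP/card0_eq/(_ k)].
  by rewrite -[_ \in _]/(c k == c k) eqxx.
have t0 : vsval t = 0.
  apply: (simple_centerless simple_g) => u; rewrite lieC -adE.
  suff -> : ad (vsval t) = 0 by rewrite zero_lfunE oppr0.
  by apply: (lfun_basis_ext ec.1) => k; rewrite ec.2 c0 scale0r zero_lfunE.
move/negP: a0; apply; apply/eqP/lfunP => H; rewrite zero_lfunE.
have := killing_coroot H xa ya; rewrite -tE t0 killingC killing0r => /esym/eqP.
by rewrite mulf_eq0 (negPf nz) orbF => /eqP.
Qed.

End RootLength.

(** * The grading by eigenvalues of [ad H] *)

Section Grading.
Variables (K : numFieldType) (g : lieAlgType K) (h : {vspace g}).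
Variables (n : nat) (Pi : n.-tuple (weight h)) (q : 'I_n).
Hypothesis simple_g : simple_lie g.
Hypothesis killing_neq0 : exists x y : g, killing x y <> 0.
Hypothesis cartan_h : cartan_subalgebra h.
Hypothesis base_Pi : root_base Pi.
Variable H : subvs_of h.
Hypothesis H_coord : forall a : weight h, (a H : K) = coord Pi q a.
Implicit Types (x y z : g) (a b : weight h) (c d : K).

Let nondeg := killing_nondegenerate simple_g killing_neq0.

Definition geig c : {vspace g} := lker (ad (vsval H) - c *: \1%VF).

Lemma geigP c x : reflect (lie (vsval H) x = c *: x) (x \in geig c).
Proof.
rewrite memv_ker add_lfunE opp_lfunE scale_lfunE id_lfunE adE subr_eq0.
exact: eqP.
Qed.

Lemma root_space_geig a : (root_space a <= geig (a H))%VS.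
Proof. by apply/subvP => x /root_spaceP xa; apply/geigP. Qed.

Lemma mem_root_geig a c x : x \in root_space a -> a H = c -> x \in geig c.
Proof. by move=> xa <-; apply: subvP (root_space_geig a) _ xa. Qed.

Lemma cartan_geig : (h <= geig 0)%VS.
Proof.
rewrite -(root_space0 cartan_h); apply/subvP => x x0.
by apply: mem_root_geig x0 _; rewrite zero_lfunE.
Qed.

Lemma lie_geig c d x y : x \in geig c -> y \in geig d -> lie x y \in geig (c + d).
Proof.
move=> /geigP xc /geigP yd; apply/geigP.
by rewrite lie_der xc yd lieZl lieZr scalerDl.
Qed.

Lemma killing_geig c d x y :
  x \in geig c -> y \in geig d -> killing x y != 0 -> d = - c.
Proof.
move=> /geigP xc /geigP yd nz; have := killing_invariant x (vsval H) y.
by rewrite lieC xc yd -scaleNr killingZl killingZr => /(mulIf nz).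
Qed.

(** The preimage of [U] under the projection onto [geig c] contains [h] and all root spaces, hence
    is everything. *)
Lemma geig_ind (U : {vspace g}) c : (c = 0 -> (h <= U)%VS) ->
  (forall a, lie_root a -> a H = c -> (root_space a <= U)%VS) ->
  (geig c <= U)%VS.
Proof.
move=> hU rU; have [m [e [l el]]] := cartan_eigenbasis cartan_h H.
have QU : forall x, x \in (eigproj e l (pred1 c) @^-1: U)%VS.
  apply: (root_decomposition cartan_h) => [|a ra].
    apply/subvP => x xh; rewrite -memv_preim.
    have /geigP xH := subvP cartan_geig _ xh.
    rewrite (@eigproj_eigenvector _ _ _ _ _ _ el _ _ 0) ?adE //=.
    have [c0|] := eqVneq 0 c; last by rewrite scale0r mem0v.
    by rewrite scale1r; apply: subvP (hU _) _ xh.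
  apply/subvP => x xa; rewrite -memv_preim.
  have /geigP xH := subvP (root_space_geig a) _ xa.
  rewrite (@eigproj_eigenvector _ _ _ _ _ _ el _ _ (a H)) ?adE //=.
  have [ac|] := eqVneq (a H) c; last by rewrite scale0r mem0v.
  by rewrite scale1r; apply: subvP (rU _ _ _) _ xa.
apply/subvP => x /geigP xc; have := QU x; rewrite -memv_preim.
by rewrite (@eigproj_eigenvector _ _ _ _ _ _ el _ _ c) ?adE //= eqxx scale1r.
Qed.

Lemma geig_pairing c x : x \in geig c -> x != 0 ->
  exists2 y, y \in geig (- c) & killing x y != 0.
Proof.
move=> xc x0; apply: contrapT => none; move/eqP: x0; apply; apply: nondeg => y.
have H0 z d : z \in geig d -> killing x z = 0.
  move=> zd; apply/eqP/negPn/negP => nz; apply: none; exists z => //.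
  by rewrite -(killing_geig xc zd nz).
apply/eqP; rewrite -memv_killf; apply: (root_decomposition cartan_h) => [|b _].
  by apply/subvP => z /(subvP cartan_geig) /H0 z0; rewrite memv_killf z0.
by apply/subvP => z /(subvP (root_space_geig b)) /H0 z0; rewrite memv_killf z0.
Qed.

Lemma simple_root_H k : (tnth Pi k H : K) = (k == q)%:R.
Proof.
case: base_Pi => fPi _ _.
by rewrite H_coord (tnth_nth 0) coord_free.
Qed.

Lemma nonneg_comb_H a (c : 'I_n -> nat) :
  a = \sum_(k < n) tnth Pi k *+ c k -> (a H : K) = (c q)%:R.
Proof.
move=> ->; rewrite sum_lfunE (bigD1 q) //= big1 => [|k kq].
  by rewrite addr0 H_coord linearMn /= -H_coord simple_root_H eqxx.
by rewrite H_coord linearMn /= -H_coord simple_root_H (negPf kq) mul0rn.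
Qed.

Lemma levi_nonneg_comb a :
  nonneg_comb Pi a -> (a H : K) = 0 -> levi_root Pi q a.
Proof.
case=> c ac; rewrite (nonneg_comb_H ac) => /eqP; rewrite pnatr_eq0 => /eqP cq.
rewrite /levi_root ac; apply: rpred_sum => k _.
have [->|kq] := eqVneq k q; first by rewrite cq mulr0n mem0v.
by apply/rpredMn/memv_span/map_f; rewrite mem_filter kq mem_enum.
Qed.

(** The value at [H] is the coefficient of the simple root [q]; a root without that coefficient is,
    up to sign, a combination of the other simple roots. *)
Lemma levi_rootP a : lie_root a -> (levi_root Pi q a <-> (a H : K) = 0).
Proof.
move=> ra; split=> [|a0].
  rewrite /levi_root H_coord => al.
  suff: a \in lker (linfun (coord Pi q : weight h -> K^o)).
    by rewrite memv_ker lfunE => /eqP.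
  apply: subvP al; apply/span_subvP => _ /mapP[k + ->].
  rewrite mem_filter => /andP[kq _].
  by rewrite memv_ker lfunE /= -H_coord simple_root_H (negPf kq).
case: base_Pi => _ _ /(_ _ ra)[ac|ac]; first exact: levi_nonneg_comb.
have: levi_root Pi q (- a).
  by apply: levi_nonneg_comb => //; rewrite opp_lfunE a0 oppr0.
by rewrite /levi_root memvN.
Qed.

Lemma root_H a : lie_root a ->
  (nonneg_comb Pi a /\ exists i : nat, (a H : K) = i%:R) \/
  (nonneg_comb Pi (- a) /\ exists i : nat, (a H : K) = - i%:R).
Proof.
move=> ra; case: base_Pi => _ _ /(_ _ ra)[ac|ac]; [left|right]; split=> //.
  by case: ac => c /nonneg_comb_H ->; exists (c q).
case: ac => c /nonneg_comb_H; rewrite opp_lfunE => aH; exists (c q).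
by rewrite -aH opprK.
Qed.

Lemma root_pos a (i : nat) :
  lie_root a -> (a H : K) = i.+1%:R -> positive_root Pi a /\ ~ levi_root Pi q a.
Proof.
move=> ra aH; split; last first.
  by move/(levi_rootP ra)/eqP; rewrite aH pnatr_eq0.
split=> //; case: (root_H ra) => [[]//|[_ [j]]].
rewrite aH => /eqP; rewrite -addr_eq0 -natrD pnatr_eq0 addSn //.
Qed.

Lemma geig_nilrad (i : nat) : (geig i.+1%:R <= nilrad Pi q)%VS.
Proof.
apply: geig_ind => [/eqP|a ra aH]; first by rewrite pnatr_eq0.
apply/subvP => x xa; apply: mem_vspan; exists a; split=> //.
exact: root_pos aH.
Qed.

Lemma geig_opp_nilrad (i : nat) : (geig (- i.+1%:R) <= opp_nilrad Pi q)%VS.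
Proof.
apply: geig_ind => [/eqP|a ra aH]; first by rewrite oppr_eq0 pnatr_eq0.
apply/subvP => x xa; apply: mem_vspan; exists a; split=> //.
apply: (@root_pos _ i); first exact: lie_root_opp.
by rewrite opp_lfunE aH opprK.
Qed.

Lemma pos_nonlevi_H a : positive_root Pi a -> ~ levi_root Pi q a ->
  exists i : nat, (a H : K) = i.+1%:R.
Proof.
case=> ra [c /nonneg_comb_H aH] /(levi_rootP ra); rewrite aH.
by case: (c q) => [[]//|i _]; exists i.
Qed.

Lemma nilrad_ind (U : {vspace g}) :
  (forall i : nat, (geig i.+1%:R <= U)%VS) -> (nilrad Pi q <= U)%VS.
Proof.
move=> EU; apply: vspan_sub => x [a [ra [pa la] xa]].
have [i aH] := pos_nonlevi_H pa la.
exact: subvP (EU i) _ (mem_root_geig xa aH).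
Qed.

Lemma opp_nilrad_ind (U : {vspace g}) :
  (forall i : nat, (geig (- i.+1%:R) <= U)%VS) -> (opp_nilrad Pi q <= U)%VS.
Proof.
move=> EU; apply: vspan_sub => x [a [ra [pa la] xa]].
have [i aH] := pos_nonlevi_H pa la.
apply: subvP (EU i) _ (mem_root_geig xa _).
by rewrite -aH opp_lfunE opprK.
Qed.

Lemma geig_levi : (geig 0 <= levi Pi q)%VS.
Proof.
apply: geig_ind => [_|a ra aH]; first exact: addvSl.
apply: subv_trans (addvSr _ _); apply/subvP => x xa; apply: mem_vspan.
by exists a; split=> //; apply/levi_rootP.
Qed.

Lemma grade1E : grade Pi q 1 = geig 1.
Proof.
rewrite /grade addv0; apply/eqP; rewrite eqEsubv; apply/andP; split.
  apply: vspan_sub => x [a [_ aq xa]].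
  by apply: mem_root_geig xa _; rewrite H_coord aq.
apply: geig_ind => [/eqP|a ra aH]; first by rewrite oner_eq0.
by apply/subvP => x xa; apply: mem_vspan; exists a; split=> //; rewrite -H_coord.
Qed.

(** Such an [s] is killed by every root, hence central in [g]. *)
Lemma roots_vanish (s : subvs_of h) :
  (forall k, (tnth Pi k s : K) = 0) -> s = 0.
Proof.
move=> s0.
have c0 a : nonneg_comb Pi a -> (a s : K) = 0.
  case=> c ->; rewrite sum_lfunE big1 // => k _.
  elim: (c k) => [|i IHi]; first by rewrite mulr0n zero_lfunE.
  by rewrite mulrS add_lfunE IHi s0 addr0.
have r0 a : lie_root a -> (a s : K) = 0.
  move=> ra; case: base_Pi => _ _ /(_ _ ra)[/c0//|/c0].
  by rewrite opp_lfunE => /eqP; rewrite oppr_eq0 => /eqP.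
apply: val_inj => /=; apply: (simple_centerless simple_g) => y.
apply/eqP; rewrite lieC oppr_eq0 -adE -memv_ker.
apply: (root_decomposition cartan_h) => [|a ra]; apply/subvP => x xa.
  rewrite memv_ker adE; case: cartan_h => -> //; exact: subvsP.
by rewrite memv_ker adE; have /root_spaceP -> := xa; rewrite r0 // scale0r.
Qed.

(** This is the Killing dual of the simple root, a multiple of the usual coroot, realised as a
    bracket of root vectors. The default 0 is never taken, by [simple_corootP]. *)
Definition simple_coroot k : g :=
  let x := vpick (root_space (tnth Pi k)) in
  xget 0 [set t | exists2 y, y \in root_space (- tnth Pi k) &
            killing x y = 1 /\ t = lie x y].

Lemma simple_corootP k : exists x y,
  [/\ x \in root_space (tnth Pi k), y \in root_space (- tnth Pi k),
      killing x y = 1 & simple_coroot k = lie x y].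
Proof.
case: base_Pi => _ /(_ k) rk _; have [_ r0] := rk.
have := vpick0 (root_space (tnth Pi k)); rewrite (negPf r0) => /negbT p0.
have [y ya ky] := root_space_pairing cartan_h nondeg (memv_pick _) p0.
rewrite /simple_coroot; case: xgetP => [t _ [z za [kz ->]]|none].
  by exists (vpick (root_space (tnth Pi k))), z; split=> //; apply: memv_pick.
by case: (none (lie (vpick (root_space (tnth Pi k))) y)); exists y.
Qed.

(** If [z] is orthogonal to these elements, all simple roots vanish on its component in [h], which
    is therefore 0; the rest of [z] is orthogonal to [h]. *)
Lemma cartan_span_coroots : (h <= <<codom simple_coroot>>)%VS.
Proof.
apply/subvP => s sh; apply: (killing_double_perp simple_g killing_neq0) => z zt.
pose perp := vspan [set z : g | forall H' : subvs_of h, killing z (vsval H') = 0].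
have perpP u : u \in perp -> forall H' : subvs_of h, killing u (vsval H') = 0.
  move=> up H'; rewrite killingC; apply/eqP; rewrite -memv_killf.
  by apply: vspan_ind up _ => v vp; rewrite memv_killf killingC vp.
have /memv_addP[z0 z0h [z1 /perpP z1p zE]] : z \in (h + perp)%VS.
  apply: (root_decomposition cartan_h); first exact: addvSl.
  move=> a [a0 _]; apply: subv_trans (addvSr _ _); apply/subvP => x xa.
  apply: mem_vspan => H'; apply/eqP/negPn/negP => nz.
  have H'0 : vsval H' \in root_space (0 : weight h).
    by rewrite root_space0 // subvsP.
  move: nz; rewrite killingC => /(killing_root_space H'0 xa).
  by rewrite oppr0 => /eqP; rewrite (negPf a0).
have /mem_cartanP[H0 H0E] := z0h.
suff z00 : H0 = 0.
  have /mem_cartanP[s' s'E] := sh.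
  by rewrite zE H0E z00 linear0 add0r s'E z1p.
apply: roots_vanish => k.
have [x [y [xa ya kxy tk]]] := simple_corootP k.
have := zt _ (memv_span (codom_f simple_coroot k)).
have /mem_cartanP[H' H'E] := lie_root_opp_mem cartan_h xa ya.
rewrite zE killingDl tk {2}H'E z1p addr0 killingC H0E.
by rewrite (killing_coroot _ xa ya) kxy mulr1.
Qed.

(** * Traces on sums of graded pieces *)

Section GradedTrace.
Variables (m : nat) (e : m.-tuple g) (l : 'I_m -> K).
Hypothesis el : eigenbasis (ad (vsval H)) e l.
Implicit Type I : pred K.

Definition gtrace I x : K := lfun_trace (eigproj e l I \o ad x)%VF.

Fact gtrace_is_linear I : scalar (gtrace I).
Proof.
move=> c x y; rewrite /gtrace linearP comp_lfunDr -comp_lfunZr.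
exact: lfun_trace_is_linear.
Qed.

HB.instance Definition _ I :=
  GRing.isLinear.Build K g K^o _ (gtrace I) (gtrace_is_linear I).

(** For [y] of degree [c], this makes the sum of the pieces with degree in [I] stable under [ad y]:
    a piece that would leave the sum is killed. *)
Definition gstable I c y :=
  forall d x, I d -> x \in geig d -> I (c + d) \/ lie y x = 0.

Lemma gtrace_lie I c d y z : y \in geig c -> z \in geig d ->
  gstable I c y -> gstable I d z -> gtrace I (lie y z) = 0.
Proof.
have st c' y' : y' \in geig c' -> gstable I c' y' ->
    (eigproj e l I \o ad y' \o eigproj e l I = ad y' \o eigproj e l I)%VF.
  move=> yc sy; apply: (eigproj_stable el) => k Ik.
  have ek : e`_k \in geig (l k) by apply/geigP; rewrite -adE el.2.
  have /geigP := lie_geig yc ek; rewrite -adE => yek.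
  rewrite adE (eigproj_eigenvector el _ yek).
  by case: (sy _ _ Ik ek) => [->|->]; rewrite ?scale1r ?scaler0.
move=> yc zd sy sz; rewrite /gtrace ad_lie.
by apply: lfun_trace_stable; rewrite ?(eigproj_idem el) ?(st _ _ yc) ?(st _ _ zd).
Qed.

(* The centre of the Levi factor is spanned by [H] because the parabolic is
   maximal, hence a trace form on the Levi factor is a multiple of
   [killing H]. *)
Lemma gtrace_levi I : exists c, forall x, x \in geig 0 ->
  gtrace I x = c * killing (vsval H) x.
Proof.
exists (gtrace I (simple_coroot q)) => x x0; set c := gtrace _ (simple_coroot q).
have triv y : gstable I 0 y by move=> d z Id _; left; rewrite add0r.
pose F : dual g := linfun (gtrace I : g -> K^o) - c *: killf (vsval H).
have FE y : (y \in lker F) = (gtrace I y == c * killing (vsval H) y).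
  by rewrite memv_ker add_lfunE opp_lfunE scale_lfunE lfunE killfE subr_eq0.
suff: x \in lker F by rewrite FE => /eqP.
apply: (subvP _ _ x0) => {x x0}; apply: geig_ind => [_|a [a0 ra] aH].
  (* For [k != q] the element is a commutator inside g(0) and both sides vanish; for [k = q]
     equality is the choice of [c]. *)
  apply: subv_trans cartan_span_coroots _; apply/span_subvP => _ /codomP[k ->].
  have [x [y [xa ya kxy tk]]] := simple_corootP k; rewrite FE.
  have -> : killing (vsval H) (simple_coroot k) = (k == q)%:R.
    by rewrite killingC tk (killing_coroot _ xa ya) kxy mulr1 simple_root_H.
  have [->|kq] := eqVneq k q; first by rewrite mulr1.
  rewrite mulr0 tk (@gtrace_lie I 0 0) //.
    by apply: mem_root_geig xa _; rewrite simple_root_H (negPf kq).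
  by apply: mem_root_geig ya _; rewrite opp_lfunE simple_root_H (negPf kq) oppr0.
apply/subvP => x xa; rewrite FE.
have -> : killing (vsval H) x = 0.
  apply/eqP/negPn/negP => nz.
  have H0 : vsval H \in root_space (0 : weight h).
    by rewrite root_space0 // subvsP.
  have := killing_root_space H0 xa nz.
  by rewrite oppr0 => /eqP; rewrite (negPf a0).
(* A root vector of degree 0 is a multiple of its bracket with a suitable [H'], so its trace
   vanishes too. *)
have [H' aH'] : exists H', (a H' : K) != 0.
  apply: contrapT => none; move/negP: a0; apply; apply/eqP/lfunP => H'.
  rewrite zero_lfunE; apply/eqP/negPn/negP => nz; apply: none; by exists H'.
have -> : x = (a H' : K)^-1 *: lie (vsval H') x.
  by have /root_spaceP -> := xa; rewrite scalerA mulVf // scale1r.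
rewrite mulr0; have := gtrace_is_linear I (a H' : K)^-1 (lie (vsval H') x) 0.
rewrite addr0 => ->; rewrite (@gtrace_lie I 0 0) //.
- by rewrite mulr0 add0r; apply/eqP; apply: linear0.
- by apply: (subvP cartan_geig); apply: subvsP.
- exact: mem_root_geig xa aH.
Qed.

(** The bracket of [y] and [z] has trace zero, yet pairs with [H] to [c * killing y z], which is
    nonzero. So the factor relating the trace form to [killing H] is zero, and [H] itself has trace
    zero. *)
Lemma graded_trace I c y z : c != 0 -> y \in geig c -> z \in geig (- c) ->
    killing y z != 0 -> gstable I c y -> gstable I (- c) z ->
  \sum_(k | I (l k)) l k = 0.
Proof.
move=> c0 yc zc nz sy sz; rewrite -(trace_eigproj el) -/(gtrace I (vsval H)).
have [d dP] := gtrace_levi I.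
have yz0 : lie y z \in geig 0 by rewrite -(subrr c) lie_geig.
have := dP _ yz0; rewrite (gtrace_lie yc zc sy sz) -killing_invariant.
have /geigP -> := yc; rewrite killingZl.
move/esym/eqP; rewrite mulrA !mulf_eq0 (negPf nz) (negPf c0) !orbF => /eqP d0.
by rewrite dP ?d0 ?mul0r // (subvP cartan_geig) // subvsP.
Qed.

End GradedTrace.

Lemma eigenbasis_geig m (e : m.-tuple g) (l : 'I_m -> K) c x :
  eigenbasis (ad (vsval H)) e l -> x \in geig c -> x != 0 -> exists k, l k = c.
Proof.
move=> el /geigP xc x0.
have [k xk] : exists k, coord e k x != 0.
  apply/existsP; apply: contraNT x0 => /existsPn xk.
  rewrite (coord_basis el.1 (memvf x)) big1 // => k _.
  by move: (xk k); rewrite negbK => /eqP ->; rewrite scale0r.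
by exists k; apply: (coord_eigenvector el _ xk); rewrite adE.
Qed.

Lemma killing_eigproj m (e : m.-tuple g) (l : 'I_m -> K) c x y :
  eigenbasis (ad (vsval H)) e l -> y \in geig (- c) ->
  killing (eigproj e l (pred1 c) x) y = killing x y.
Proof.
move=> el yc; suff E : (killf y \o eigproj e l (pred1 c))%VF = killf y.
  by rewrite !(killingC _ y) -!killfE -[in RHS]E comp_lfunE.
apply: (lfun_basis_ext el.1) => k.
rewrite comp_lfunE (eigproj_basis el) linearZ /=.
have [//|lc] := eqVneq (l k) c; first by rewrite scale1r.
rewrite scale0r killfE; apply/esym/eqP/negPn/negP => nz.
have ek : e`_k \in geig (l k) by apply/geigP; rewrite -adE el.2.
by move/eqP: lc; apply; rewrite (killing_geig yc ek nz) opprK.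
Qed.

Lemma geig1_neq0 : exists2 x, x \in geig 1 & x != 0.
Proof.
case: base_Pi => _ /(_ q) [_ r0] _; exists (vpick (root_space (tnth Pi q))).
  by apply: mem_root_geig (memv_pick _) _; rewrite simple_root_H eqxx.
by rewrite vpick0.
Qed.

(** Duality: by invariance, an element of degree [- i.+2] orthogonal to the brackets on the right
    commutes with [geig 1]. *)
Lemma geig_generated_of_perp (i : nat) :
  (forall z, z \in geig (- i.+2%:R) ->
     (forall y, y \in geig 1 -> lie y z = 0) -> z = 0) ->
  (geig i.+2%:R <= lie_prod (geig 1) (geig i.+1%:R))%VS.
Proof.
move=> perp; apply/subvP => x xi.
apply: (killing_double_perp simple_g killing_neq0) => w wS.
have [m [e [l el]]] := cartan_eigenbasis cartan_h H.
(* Only this component of [w] pairs with degree [i.+2]. *)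
pose w' := eigproj e l (pred1 (- i.+2%:R)) w.
have ww' u : u \in geig i.+2%:R -> killing w' u = killing w u.
  by move=> ui; apply: killing_eigproj => //; rewrite opprK.
have w'i : w' \in geig (- i.+2%:R).
  by apply/geigP; rewrite -adE (eigproj_pred1 el).
rewrite -ww' //; suff -> : w' = 0 by rewrite killingC killing0r.
apply: perp => // y y1; apply/eqP/negPn/negP => nz.
have yw' : lie y w' \in geig (- i.+1%:R).
  have := lie_geig y1 w'i; congr (_ \in geig _).
  by rewrite -(natr1 i.+1) opprD addrCA subrr addr0.
have [v vi /negP] := geig_pairing yw' nz; apply; apply/eqP.
rewrite opprK in vi.
have yvi : lie y v \in geig i.+2%:R by rewrite -(nat1r i.+1) lie_geig.
rewrite lieC -scaleN1r killingZl killing_invariant ww' // wS ?mulr0 //.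
exact: mem_lie_prod.
Qed.

(** Strong induction on [j]: the lower cases show that degrees 1 to [j.+1] are generated by
    [geig 1], so all of them commute with [z]. A nonzero [z] would then contradict a trace
    identity. *)
Lemma geig_perp (j : nat) z : z \in geig (- j.+2%:R) ->
  (forall y, y \in geig 1 -> lie y z = 0) -> z = 0.
Proof.
elim/ltn_ind: j z => j IHj z zj z1; apply/eqP/negPn/negP => z0.
have zlow (i : nat) x : (i <= j)%N -> x \in geig i.+1%:R -> lie x z = 0.
  elim: i x => [|i IHi] x ij xi; first exact: z1.
  have xp := subvP (geig_generated_of_perp (IHj i ij)) _ xi.
  apply/eqP; rewrite lie_adr -memv_ker.
  apply: vspan_ind xp _ => _ [u [v [u1 vi ->]]].
  rewrite memv_ker -lie_adr; have := lie_der u v z.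
  rewrite (IHi v) ?(ltnW ij) // (z1 u) // !linear0 addr0 => <-.
  by rewrite eqxx.
have [y yj kyz] := geig_pairing zj z0; rewrite opprK in yj.
have [m [e [l el]]] := cartan_eigenbasis cartan_h H.
(* [I] consists of the positive degrees not divisible by [j.+2]. Raising by [j.+2] stays in [I];
   lowering leaves it only from degrees below [j.+2], where [z] acts as zero. A sum of positive
   degrees, 1 among them, would vanish. *)
pose I : pred K := fun c =>
  `[< exists2 i : nat, c = i.+1%:R & ~~ (j.+2 %| i.+1)%N >].
have sum0 : \sum_(k | I (l k)) l k = 0.
  apply: (graded_trace el _ yj zj).
  - by rewrite pnatr_eq0.
  - by rewrite killingC.
  - move=> d x /asboolP[i -> iP] _; left; apply/asboolP.
    by exists (j.+2 + i)%N; rewrite ?addnS ?natrD -?addnS ?natrD // dvdn_addr.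
  - move=> d x /asboolP[i -> iP] xd.
    have [ij|ij] := leqP i j; first by right; rewrite lieC (zlow i) ?oppr0.
    left; apply/asboolP; exists (i - j.+2)%N.
      rewrite -subSn; last first.
        by rewrite ltn_neqAle ij andbT; apply: contra iP => /eqP <-.
      by rewrite natrB 1?addrC.
    rewrite -subSn; last first.
      by rewrite ltn_neqAle ij andbT; apply: contra iP => /eqP <-.
    by apply: contra iP => iP; rewrite -(@subnK j.+2 i.+1) // dvdn_addl.
have [x x1 x0] := geig1_neq0.
have [k lk] := eigenbasis_geig el x1 x0.
have Ik : I (l k) by apply/asboolP; exists 0%N; rewrite // lk.
have lge0 i : I (l i) -> 0 <= l i by move=> /asboolP[i' -> _]; apply: ler0n.
by have /eqP := psumr_eq0P lge0 sum0 Ik; rewrite lk oner_eq0.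
Qed.

Lemma geig_generated (i : nat) :
  (geig i.+2%:R <= lie_prod (geig 1) (geig i.+1%:R))%VS.
Proof. by apply: geig_generated_of_perp => z; apply: geig_perp. Qed.

(** * Consequences of two-step nilpotency *)

Section TwoStep.
Hypothesis two_step :
  lie_prod (nilrad Pi q) (lie_prod (nilrad Pi q) (nilrad Pi q)) = 0%VS.
Hypothesis nonabelian : lie_prod (nilrad Pi q) (nilrad Pi q) != 0%VS.

(** Degree 3 consists of double brackets in the nilradical; generation by [geig 1] propagates the
    vanishing upwards. *)
Lemma geig_ge3 (i : nat) : geig i.+3%:R = 0%VS.
Proof.
elim: i => [|i IHi]; apply/eqP; rewrite -subv0.
  apply: subv_trans (geig_generated 1) _; rewrite -two_step.
  apply: lie_prodS; first exact: (geig_nilrad 0).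
  apply: subv_trans (geig_generated 0) _.
  by apply: lie_prodS; apply: (geig_nilrad 0).
by apply: subv_trans (geig_generated i.+2) _; rewrite IHi lie_prod0r.
Qed.

Lemma geig_le_opp3 (i : nat) : geig (- i.+3%:R) = 0%VS.
Proof.
apply/eqP; rewrite -subv0; apply/subvP => z zi; rewrite memv0.
apply/negPn/negP => z0.
have [y] := geig_pairing zi z0; rewrite opprK geig_ge3 memv0 => /eqP ->.
by rewrite killing0r eqxx.
Qed.

(** Otherwise [geig 1] is commutative, so degree 2 vanishes and the nilradical, reduced to [geig 1],
    is abelian. *)
Lemma noncommuting_roots : exists (a b : weight h) x y,
  [/\ lie_root a, a H = 1, lie_root b, b H = 1 &
  [/\ x \in root_space a, y \in root_space b & lie x y != 0]].
Proof.
apply: contrapT => none; move/negP: nonabelian; apply; rewrite -subv0.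
have c1 x y : x \in geig 1 -> y \in geig 1 -> lie x y = 0.
  move=> x1 y1; apply/eqP; rewrite -adE -memv_ker; apply: subvP y1.
  apply: geig_ind => [/eqP|b rb bH]; first by rewrite oner_eq0.
  apply/subvP => {}y yb; rewrite memv_ker adE lie_adr -memv_ker; apply: subvP x1.
  apply: geig_ind => [/eqP|a ra aH]; first by rewrite oner_eq0.
  apply/subvP => {}x xa; rewrite memv_ker -lie_adr; apply/negPn/negP => nz.
  by apply: none; exists a, b, x, y.
have p1 : lie_prod (geig 1) (geig 1) = 0%VS.
  apply/eqP; rewrite -subv0; apply: vspan_sub => _ [x [y [x1 y1 ->]]].
  by rewrite c1 // mem0v.
rewrite -p1; suff n1 : (nilrad Pi q <= geig 1)%VS by apply: lie_prodS.
apply: nilrad_ind => -[//|[|i]]; last by rewrite geig_ge3 sub0v.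
by apply: subv_trans (geig_generated 0) _; rewrite p1 sub0v.
Qed.

(** For nonzero [z], the trace of [ad H] would vanish both on [g] and on the sum of all pieces but
    g(-2); the difference is -2 times the dimension of g(-2). *)
Lemma geig_opp1_centralizer z : z \in geig (-1) ->
  (forall y, y \in geig (-1) -> lie y z = 0) ->
  (exists2 w, w \in geig (- 2%:R) & w != 0) -> z = 0.
Proof.
move=> z1 zc [w w2 w0]; apply/eqP/negPn/negP => z0.
have [y y1 kzy] := geig_pairing z1 z0; rewrite opprK in y1.
have [m [e [l el]]] := cartan_eigenbasis cartan_h H.
have kyz : killing y z != 0 by rewrite killingC.
have sumT : \sum_k l k = 0.
  apply: (@graded_trace _ _ _ el predT 1 y z) => //; first exact: oner_neq0.
  - by move=> *; left.
  - by move=> *; left.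
(* Degree -2 could be entered only from degree -3, which is zero, by [y], or from degree -1, which
   commutes with [z], by [z]. *)
have sumI : \sum_(k | l k != - 2%:R) l k = 0.
  apply: (@graded_trace _ _ _ el (fun c => c != - 2%:R) 1 y z) => //.
  - exact: oner_neq0.
  - move=> d x d2 xd; have [d3|d3] := eqVneq d (- 3%:R).
      right; move: xd; rewrite d3 geig_le_opp3 memv0 => /eqP ->; exact: linear0.
    left; apply: contra d3 => /eqP d3; apply/eqP.
    by rewrite -[d](addKr 1) d3 -opprD nat1r.
  - move=> d x d2 xd; have [d1|d1] := eqVneq d (- 1).
      by right; rewrite lieC zc ?oppr0 // -d1.
    left; apply: contra d1 => /eqP d1; apply/eqP.
    by rewrite -[d](addNKr 1) d1 -(nat1r 1) opprD addrA subrr sub0r.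
have [k lk] := eigenbasis_geig el w2 w0.
move/eqP: sumT; rewrite (bigID (fun k => l k == - 2%:R)) /= sumI addr0.
rewrite (eq_bigr (fun=> - 2%:R)) => [|i /eqP //].
rewrite sumr_const mulrn_eq0 oppr_eq0 pnatr_eq0 orbF.
by move/eqP/card0_eq/(_ k); rewrite -[_ \in _]/(l k == _) lk eqxx.
Qed.

(** Modulo [x], [x'] can be replaced by some [u] commuting with a dual vector [f]. The double
    bracket of [x] with [u] has degree 3, so is 0; applying [ad f] to it gives [-3 a(t) [x, u] = 0],
    where [a(t)] is nonzero. *)
Lemma root_space_commutes (a : weight h) x x' : a H = 1 ->
  x \in root_space a -> x' \in root_space a -> lie x x' = 0.
Proof.
move=> aH xa xa'; have [->|x0] := eqVneq x 0; first exact: lie0l.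
have a0 : a != 0.
  by apply/eqP => a0; move/eqP: aH; rewrite a0 zero_lfunE eq_sym oner_eq0.
have [f fa kxf] := root_space_pairing cartan_h nondeg xa x0.
have /mem_cartanP[t tE] := lie_root_opp_mem cartan_h xa fa.
have r0 : (a t : K) != 0.
  apply: (root_nonisotropic simple_g cartan_h a0 xa fa); last by rewrite tE.
  by rewrite kxf oner_eq0.
(* The multiple of [x] makes [killing u f] zero, hence also the bracket of [u] and [f] by
   [lie_coroot]. *)
pose u := x' - killing x' f *: x.
have ua : u \in root_space a by rewrite memvB // memvZ.
have fu : lie f u = 0.
  have := lie_coroot cartan_h nondeg xa fa ua fa; rewrite kxf scale1r.
  rewrite killingBl killingZl kxf mulr1 subrr scale0r.
  by rewrite (lieC u) => /esym/eqP; rewrite oppr_eq0 => /eqP.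
have xx' : lie x x' = lie x u by rewrite linearB /= lieZr lie_alt scaler0 subr0.
have tz b z : z \in root_space b -> lie (vsval t) z = (b t : K) *: z.
  by move/root_spaceP.
have fx : lie f x = - vsval t by rewrite lieC tE.
have fxu : lie f (lie x u) = - (a t : K) *: u.
  by rewrite lie_der fx fu linear0 addr0 lieNl (tz a) // scaleNr.
have xxu : lie x (lie x u) = 0.
  have x1 := mem_root_geig xa aH; have u1 := mem_root_geig ua aH.
  have := lie_geig x1 (lie_geig x1 u1).
  have -> : 1 + (1 + 1) = 3%:R :> K by rewrite -(nat1r 2) -(nat1r 1).
  rewrite (geig_ge3 0) memv0.
  by move/eqP.
have := lie_der f x (lie x u); rewrite xxu linear0 fx fxu lieNl.
rewrite (tz (a + a)) ?lie_root_space // lieZr add_lfunE -scaleNr -scalerDl xx'.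
move/esym/eqP; rewrite scaler_eq0 => /orP[|/eqP //].
rewrite -opprD oppr_eq0 -mulr2n -mulrSr mulrn_eq0 (negPf r0) //.
Qed.

(* For root vectors [x], [y] of grade 1 with roots [a], [b] and [f] paired with
   [lie x y], polarising [ad(Y)^2 f] at [x], [y] gives the difference of the
   Killing duals of [a] and [b]. *)
Lemma ad_square_neq0 : exists y f,
  [/\ y \in geig 1, f \in geig (- 2%:R) & lie y (lie y f) != 0].
Proof.
have [a [b [x [y [_ aH _ bH [xa yb xy0]]]]]] := noncommuting_roots.
have xy := lie_root_space xa yb.
have [f fab kf] := root_space_pairing cartan_h nondeg xy xy0.
have x1 := mem_root_geig xa aH; have y1 := mem_root_geig yb bH.
have f2 : f \in geig (- 2%:R).
  by apply: mem_root_geig fab _; rewrite opp_lfunE add_lfunE aH bH -(nat1r 1).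
apply: contrapT => none.
have sq u : u \in geig 1 -> lie u (lie u f) = 0.
  by move=> u1; apply/eqP/negPn/negP => nz; apply: none; exists u, f.
have := sq _ (memvD x1 y1); rewrite lieDl !(lieDl x y f) !linearD /=.
rewrite (sq x) // (sq y) // add0r addr0 => pol.
have yfa : lie y f \in root_space (- a).
  by have := lie_root_space yb fab; rewrite opprD addrCA subrr addr0.
have xfb : lie x f \in root_space (- b).
  by have := lie_root_space xa fab; rewrite opprD addrA subrr add0r.
have ab : a = b.
  apply/lfunP => H'.
  have : killing (lie x (lie y f) + lie y (lie x f)) (vsval H') = 0.
    by rewrite pol killingC killing0r.
  rewrite killingDl (killing_coroot H' xa yfa) (killing_coroot H' yb xfb).
  rewrite -!killing_invariant kf (lieC y x) -scaleN1r killingZl kf !mulr1 mulrN1.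
  by move/eqP; rewrite subr_eq0 => /eqP.
by move/eqP: xy0; apply; apply: (root_space_commutes aH) => //; rewrite ab.
Qed.

Lemma opp_nilrad_sub : (opp_nilrad Pi q <= geig (-1) + geig (- 2%:R))%VS.
Proof.
apply: opp_nilrad_ind => -[|[|i]]; [exact: addvSl | exact: addvSr |].
by rewrite geig_le_opp3 sub0v.
Qed.

(** Degree -2 is central because degrees below it vanish. Conversely, the degree -1 component of a
    central element centralizes g(-1), so it is 0 as g(-2) is nonzero. *)
Lemma centre_opp_nilrad : centre (opp_nilrad Pi q) = geig (- 2%:R).
Proof.
have low y z i : y \in geig (- 2%:R) -> z \in geig (- i.+1%:R) -> lie y z = 0.
  move=> y2 zi; apply/eqP; rewrite -memv0 -(geig_le_opp3 i).
  by have := lie_geig y2 zi; rewrite -opprD -natrD.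
have [Y [f [_ f2 nz]]] := ad_square_neq0.
have f0 : f != 0 by apply: contraNneq nz => ->; rewrite !linear0.
apply/vspaceP => z; apply/idP/idP => [/mem_centre[zn zc]|z2]; last first.
  apply/mem_centre; split=> [|y yn]; first exact: (subvP (geig_opp_nilrad 1)).
  apply/eqP; rewrite -adE -memv_ker; apply: subvP yn; apply: opp_nilrad_ind => i.
  by apply/subvP => {}y yi; rewrite memv_ker adE (low z y i).
have /memv_addP[z1 z1P [z2 z2P zE]] := subvP opp_nilrad_sub _ zn.
suff z10 : z1 = 0 by rewrite zE z10 add0r.
apply: geig_opp1_centralizer => // [y y1|]; last by exists f.
have := zc y (subvP (geig_opp_nilrad 0) _ y1).
rewrite zE lieDl (low z2 y 0%N) // addr0 => z1y.
by rewrite lieC z1y oppr0.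
Qed.

End TwoStep.
End Grading.

(** * Nonvanishing of the covariant map *)

(** If the Killing dual of the simple root had norm 0, the numerator of its diagonal Cartan integer
    would be 0, while that integer is 2. *)
Lemma killing_neq0_of_type (K : numFieldType) (g : lieAlgType K)
    (h : {vspace g}) (T : dynkin) (Pi : (rank_of T).-tuple (weight h)) :
  has_type Pi -> 'I_(rank_of T) -> exists x y : g, killing x y <> 0.
Proof.
move=> typ q; pose t := vsval (killing_dual (tnth Pi q)).
exists t, t => t0; have := typ q q.
rewrite /cartan_integer /weight_form -/t t0 mulr0 mul0r /cartan_entry eqxx.
by move/esym/eqP; rewrite intr_eq0.
Qed.

Lemma quasi_heisenberg_ad_square (K : numFieldType) (g : lieAlgType K)
    (h : {vspace g}) n (Pi : n.-tuple (weight h)) (q : 'I_n) :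
    simple_lie g -> (exists x y : g, killing x y <> 0) ->
    cartan_subalgebra h -> root_base Pi -> quasi_heisenberg Pi q ->
  (forall y z, y \in grade Pi q 1 -> z \in centre (opp_nilrad Pi q) ->
     lie y (lie y z) \in levi Pi q) /\
  (exists y z, [/\ y \in grade Pi q 1, z \in centre (opp_nilrad Pi q) &
     lie y (lie y z) != 0]).
Proof.
move=> sg kn ch bP [step2 dim2].
have nonab : lie_prod (nilrad Pi q) (nilrad Pi q) != 0%VS.
  by apply: contraTneq dim2 => ->; rewrite dimv0.
(* Weights form the dual of [h], so by reflexivity the coefficient of the simple root [q] is
   evaluation at some [H]. *)
have [H HP] := dual_evaluation (linfun (coord Pi q : weight h -> K^o)).
have Hq (a : weight h) : (a H : K) = coord Pi q a by rewrite HP lfunE.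
rewrite (grade1E ch Hq) (centre_opp_nilrad sg kn ch bP Hq step2 nonab).
split=> [y z y1 z2|]; last exact: (ad_square_neq0 sg kn ch bP Hq step2 nonab).
apply: (subvP (geig_levi ch bP Hq)).
have := lie_geig y1 (lie_geig y1 z2).
by rewrite addrA -(nat1r 1) subrr.
Qed.

Lemma tau2_omega (K : fieldType) (g : lieAlgType K) m (X Xs : m.-tuple g) Y :
  tau2 (omega X Xs) Y =
  2^-1 *: \sum_(j < m) pure (lie Y (lie Y (tnth Xs j))) (tnth X j).
Proof.
rewrite /tau2 /omega; congr (_ *: _).
have tensor_map_sum f (t : 'I_m -> tensor g g) :
    tensor_map f \1%VF (\sum_(j < m) t j) = \sum_(j < m) tensor_map f \1%VF (t j).
  apply/lfunP => phi; rewrite /tensor_map !comp_lfunE !sum_lfunE linear_sum.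
  by apply: eq_bigr => j _; rewrite !comp_lfunE.
rewrite tensor_map_sum; apply: eq_bigr => j _.
by rewrite tensor_map_pure id_lfunE comp_lfunE !adE.
Qed.

(** Contracting the first factor with a coordinate functional leaves a linear relation on the free
    family [X], so each coordinate of each [u] entry is 0. *)
Lemma pure_sum_eq0 (K : fieldType) (V : vectType K) m (X u : m.-tuple V) :
  free X -> \sum_(j < m) pure (tnth u j) (tnth X j) = 0 ->
  forall j, tnth u j = 0.
Proof.
move=> fX s0 j; rewrite (coord_vbasis (memvf (tnth u j))) big1 // => k _.
pose phi : dual V := linfun (coord (vbasis {:V}) k : V -> K^o).
have := congr1 (fun t : tensor V V => coord X j (t phi)) s0.
rewrite zero_lfunE linear0 sum_lfunE.
under eq_bigr => i _ do rewrite lfunE /= /pure_fun (tnth_nth 0 X).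
by rewrite coord_sum_free // lfunE /= => ->; rewrite scale0r.
Qed.

Theorem proposition7p3 (R : realType) (g : lieAlgType R[i])
    (h b : {vspace g}) (T : dynkin) (Pi : (rank_of T).-tuple (weight h))
    (q : 'I_(rank_of T))
    (m : nat) (X Xs : m.-tuple g) :
  simple_lie g ->
  cartan_subalgebra h ->
  borel b -> (h <= b)%VS ->
  simple_roots_of Pi b ->
  has_type Pi ->
  listed_type T q.+1 ->
  quasi_heisenberg Pi q ->
  dual_bases (centre (nilrad Pi q)) (centre (opp_nilrad Pi q)) X Xs ->
  (forall Y, Y \in grade Pi q 1 ->
     tau2 (omega X Xs) Y \in tensor_sub (levi Pi q) (centre (nilrad Pi q))) /\
  ~ (forall Y, Y \in grade Pi q 1 -> tau2 (omega X Xs) Y = 0).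
Proof.
move=> sg ch _ _ [bP _] typ _ qH [bX bXs _].
have kn : exists x y : g, killing x y <> 0 := killing_neq0_of_type typ q.
have [sqlevi [y [z [y1 zc nz]]]] := quasi_heisenberg_ad_square sg kn ch bP qH.
split=> [Y Y1|tau0].
  rewrite tau2_omega; apply/memvZ/rpred_sum => j _; apply: mem_vspan.
  exists (lie Y (lie Y (tnth Xs j))), (tnth X j); split=> //.
    by apply: sqlevi => //; apply: (basis_mem bXs); apply: mem_tnth.
  by apply: (basis_mem bX); apply: mem_tnth.
pose u := [tuple lie y (lie y (tnth Xs j)) | j < m].
have u0 j : tnth u j = 0.
  apply: (pure_sum_eq0 (basis_free bX)); have /eqP := tau0 y y1.
  rewrite tau2_omega scaler_eq0 invr_eq0 pnatr_eq0 /= => /eqP s0.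
  by rewrite -[RHS]s0; apply: eq_bigr => i _; rewrite tnth_mktuple.
(* The entries of [Xs] span the centre containing [z], so the square of [ad y] would kill [z]. *)
move/negP: nz; apply; rewrite (coord_basis bXs zc) !linear_sum big1 //= => j _.
have := u0 j; rewrite tnth_mktuple (tnth_nth 0) => yyX.
by rewrite !linearZ /= yyX scaler0.
Qed.
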